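(* Let $r\ge1$, $N=2r+2$, and let $\lambda=(\lambda_1\ge\dots\ge\lambda_N\ge0)$ be a partition with at most $N$ parts. Then $$s_\lambda(1,-1,z_1,z_1^{-1},\dots,z_r,z_r^{-1})=0\quad\text{(identically in } z_1,\dots,z_r)$$ if and only if at least one of the following holds: (a) the numbers $\beta_j=\lambda_j+N-j$ ($1\le j\le N$) are all even or all odd; (b) $\lambda$ is self-complementary of odd width: there is an odd integer $w$ such that $\lambda_i+\lambda_{N+1-i}=w$ for every $1\le i\le N$.
   Context: $s_\lambda$ is the Schur polynomial in $N$ variables and $z_1,\dots,z_r$ are independent indeterminates. *)

(* Defs.v *)
From mathcomp Require Import all_boot all_order all_fingroup all_algebra.
From mathcomp Require Import mpoly.

Set Implicit Arguments.
Unset Strict Implicit.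
Unset Printing Implicit Defensive.

Import GRing.Theory.
Local Open Scope ring_scope.

Definition is_part (n : nat) (lambda : n.-tuple nat) : bool :=
  sorted geq lambda.

(* With 0-based j, the beta-number lambda_j + n - j of the 1-based convention
   reads as follows; the subtraction does not truncate since j < n. *)
Definition beta (n : nat) (lambda : n.-tuple nat) (j : 'I_n) : nat :=
  (tnth lambda j + (n - j.+1))%N.

Definition alternant (n : nat) (e : 'I_n -> nat) : {mpoly int[n]} :=
  \det (\matrix_(i < n, j < n) 'X_i ^+ e j).

Definition staircase (n : nat) (j : 'I_n) : nat := (n - j.+1)%N.

Lemma newton_interp (R : comNzRingType) (n : nat) (f : {poly R}) (x : nat -> R) :
  exists c : nat -> R, forall i, (i < n)%N ->
    f.[x i] = \sum_(k < n) (\prod_(l < k) (x i - x l)) * c k.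
Proof.
elim: n f x => [|n IHn] f x; first by exists (fun=> 0).
have /factor_theorem[g Dg] : root (f - f.[x 0]%:P) (x 0).
  by rewrite /root !hornerE subrr.
have [c cP] := IHn g (fun i => x i.+1).
exists (fun k => if k is k'.+1 then c k' else f.[x 0]) => i i_lt.
rewrite big_ord_recl big_ord0 mul1r.
have -> : f = g * ('X - (x 0)%:P) + f.[x 0]%:P by rewrite -Dg subrK.
rewrite !hornerE subrr mulr0 add0r addrC; congr (_ + _).
case: i i_lt => [|i] i_lt.
  rewrite subrr mulr0 big1 // => k _.
  by rewrite lift0 big_ord_recl subrr !mul0r.
rewrite cP // mulr_suml; apply: eq_bigr => k _.
by rewrite lift0 big_ord_recl /= mulrAC [in RHS](mulrC (x i.+1 - x 0)).
Qed.

Lemma det_horner (R : comNzRingType) (n : nat) (f : 'I_n -> {poly R})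
    (x : 'I_n -> R) :
  exists q : R, \det (\matrix_(i < n, j < n) (f j).[x i])
    = q * \prod_(i < n) \prod_(j < n | (i < j)%N) (x j - x i).
Proof.
case: n f x => [|n] f x.
  by exists 1; rewrite det_mx00 mul1r big_ord0.
pose y i := x (inord i).
have yE (i : 'I_n.+1) : y i = x i by rewrite /y inord_val.
have [c cP] : exists c : 'I_n.+1 -> nat -> R, forall j i, (i < n.+1)%N ->
    (f j).[y i] = \sum_(k < n.+1) (\prod_(l < k) (y i - y l)) * c j k.
  by apply: (fin_all_exists (fun j => newton_interp n.+1 (f j) y)).
pose L := \matrix_(i < n.+1, k < n.+1) \prod_(l < k) (y i - y l).
pose C := \matrix_(k < n.+1, j < n.+1) c j k.
exists (\det C); rewrite mulrC.
have -> : \matrix_(i, j) (f j).[x i] = L *m C.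
  apply/matrixP => i j; rewrite !mxE -yE cP //.
  by apply: eq_bigr => k _; rewrite !mxE.
rewrite det_mulmx det_trig.
  congr (_ * _); rewrite (exchange_big_dep xpredT) //=.
  apply: eq_bigr => i _; rewrite mxE.
  rewrite (big_ord_widen_cond n.+1 xpredT (fun l => y i - y l)) //=; last first.
    exact: ltnW.
  by apply: eq_bigr => l _; rewrite !yE.
apply/is_trig_mxP => i k i_lt_k; rewrite mxE.
by rewrite (bigD1 (Ordinal i_lt_k)) //= subrr mul0r.
Qed.

Lemma alternant_staircase (n : nat) : exists b : bool,
  alternant (@staircase n) =
  (-1) ^+ b * \prod_(i < n) \prod_(j < n | (i < j)%N) ('X_j - 'X_i).
Proof.
pose s := perm (@rev_ord_inj n); exists (odd_perm s).
pose a : 'rV[{mpoly int[n]}]_n := \row_i 'X_i.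
have -> : alternant (@staircase n) = \det (perm_mx s *m Vandermonde n a).
  rewrite -det_tr -row_permE; congr (\det _); apply/matrixP => i j.
  by rewrite !mxE permE.
rewrite det_mulmx det_perm det_Vandermonde; congr (_ * _).
by apply: eq_bigr => i _; apply: eq_bigr => j _; rewrite !mxE.
Qed.

Lemma alternant_staircase_neq0 (n : nat) : alternant (@staircase n) != 0.
Proof.
have [b ->] := alternant_staircase n.
rewrite mulf_neq0 ?signr_eq0 //.
apply/prodf_neq0 => i _; apply/prodf_neq0 => j i_lt_j.
apply/eqP => /(congr1 (fun p : {mpoly int[n]} => p@_U_(j)%MM)).
rewrite mcoeffB mcoeff0 !mcoeffXU eqxx.
by have /negPf-> : i != j by rewrite neq_ltn i_lt_j.
Qed.

Lemma schur_exists (n : nat) (lambda : n.-tuple nat) :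
  exists p : {mpoly int[n]},
    p * alternant (@staircase n) == alternant (beta lambda).
Proof.
have [b Db] := alternant_staircase n.
have [q Dq] := det_horner (fun j => 'X^(beta lambda j))
                          (fun i : 'I_n => 'X_i : {mpoly int[n]}).
exists (q * (-1) ^+ b).
rewrite Db -mulrA [X in q * X]mulrA -signr_addb addbb mul1r -Dq.
apply/eqP; congr (\det _); apply/matrixP => i j.
by rewrite !mxE hornerXn.
Qed.

(* The bialternant quotient a_(lambda + delta) / a_delta.  It is the only
   polynomial with this property: see alternant_staircase_neq0, the ring
   {mpoly int[n]} being an integral domain. *)
Definition schur (n : nat) (lambda : n.-tuple nat) : {mpoly int[n]} :=
  xchoose (schur_exists lambda).

Lemma schurP (n : nat) (lambda : n.-tuple nat) :
  schur lambda * alternant (@staircase n) = alternant (beta lambda).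
Proof. exact/eqP/(xchooseP (schur_exists lambda)). Qed.

Definition eval_schur (R : comNzRingType) (n : nat) (lambda : n.-tuple nat)
    (x : n.-tuple R) : R :=
  mmap intr (tnth x) (schur lambda).

(* The field of rational functions Q(z_0, ..., z_(r-1)), which contains the
   Laurent polynomials in the z_k. *)
Notation ratfun r := {fraction {mpoly int[r]}}.

Definition indet (r : nat) (k : 'I_r) : ratfun r := @FracField.tofrac _ 'X_k.

Definition points_seq (r : nat) : seq (ratfun r) :=
  [:: 1; -1] ++ flatten [seq [:: indet k; (indet k)^-1] | k <- enum 'I_r].

Lemma size_points (r : nat) : size (points_seq r) == r.*2.+2.
Proof.
rewrite /points_seq size_cat size_flatten /shape -map_comp /=.
by rewrite sumnE big_map big_enum /= sum_nat_const card_ord muln2.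
Qed.

Definition points (r : nat) : r.*2.+2.-tuple (ratfun r) := Tuple (size_points r).

(* Main.v *)
(* Up to the Vandermonde determinant, the Schur polynomial at the given points
   is the determinant with columns b and rows z_k^b, z_k^-b (1 <= k <= r), 1^b and
   (-1)^b, b running over the beta-numbers in increasing order
   b_0 < ... < b_(N-1).
   Expanding along the two rows of z_1, the coefficient of z_1^d is the signed
   sum of the determinants for z_2, ..., z_r obtained by deleting two columns
   with difference d. If only one pair of columns has difference d, vanishing is
   inherited by the exponents without that pair. This applies to the extreme
   pair and, when b_0 + b_(N-1) differs from b_1 + b_(N-2), to one of the pairs
   (b_1, b_(N-1)), (b_0, b_(N-2)); an induction then leaves the case where all
   exponents but the extreme ones have the same parity. There the last two
   rows reduce to determinants without the row of -1, which never vanish and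
   which determine the nested differences of their exponents.
   Conversely, exponents symmetric about h give r + 1 combinations of columns
   antisymmetric under z <-> z^-1, which are dependent. *)
Require Import Defs.
From mathcomp Require Import all_boot all_order all_fingroup all_algebra.
From mathcomp Require Import mpoly.
From mathcomp Require Import zify ring.

Set Implicit Arguments.
Unset Strict Implicit.
Unset Printing Implicit Defensive.

Import GRing.Theory.
Local Open Scope ring_scope.

(** * Generalized Vandermonde determinants and their row expansions *)

Definition gdet (F : fieldType) n (xs : seq F) (b : nat -> nat) : F :=
  \det (\matrix_(i < n, j < n) xs`_i ^+ b j).

(** [gdet] reads only the first [n] points; with 1 and -1 last, lowering the full size by one drops
    exactly the row of -1. *)
Definition pairs (F : fieldType) (zs : seq F) : seq F :=
  flatten [seq [:: z; z^-1] | z <- zs] ++ [:: 1; -1].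

Section GeneralizedVandermonde.
Variable F : fieldType.
Implicit Types (xs zs : seq F) (b : nat -> nat).

Lemma eq_gdet n xs b b' :
  (forall i, (i < n)%N -> b i = b' i) -> gdet n xs b = gdet n xs b'.
Proof.
by move=> eq_b; congr (\det _); apply/matrixP => i j; rewrite !mxE eq_b.
Qed.

Lemma gdet_cons n x xs b :
  gdet n.+1 (x :: xs) b =
  \sum_(j < n.+1) x ^+ b j * ((-1) ^+ j * gdet n xs (b \o bump j)).
Proof.
rewrite /gdet (expand_det_row _ ord0); apply: eq_bigr => j _.
rewrite !mxE /cofactor add0n; congr (_ * (_ * \det _)).
by apply/matrixP => i k; rewrite !mxE.
Qed.

Lemma gdet_last n xs b :
  gdet n.+1 xs b =
  \sum_(j < n.+1) xs`_n ^+ b j * ((-1) ^+ (n + j) * gdet n xs (b \o bump j)).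
Proof.
rewrite /gdet (expand_det_row _ ord_max); apply: eq_bigr => j _.
rewrite !mxE /cofactor; congr (_ * (_ * \det _)).
by apply/matrixP => i k; rewrite !mxE lift_max.
Qed.

(** The Laplace expansion along the rows of [z] and [z^-1], multiplied by [z ^+ M] to become a
    polynomial in [z]; [M] is meant to bound the exponents, so that [M - b _] does not truncate. *)
Definition pair_poly n xs b M : {poly F} :=
  \sum_(j < n.+2) \sum_(k < n.+1)
    ((-1) ^+ (j + k) * gdet n xs (b \o bump j \o bump k))
      *: 'X^(b j + (M - b (bump j k))).

Lemma horner_pair_poly n xs b M z : z != 0 ->
    (forall i, (i < n.+2)%N -> (b i <= M)%N) ->
  (pair_poly n xs b M).[z] = gdet n.+2 [:: z, z^-1 & xs] b * z ^+ M.
Proof.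
move=> z_neq0 b_le; rewrite gdet_cons mulr_suml horner_sum.
apply: eq_bigr => j _; rewrite gdet_cons !mulr_sumr mulr_suml horner_sum.
apply: eq_bigr => k _; rewrite hornerZ hornerXn exprD exprD /=.
have lM : (b (bump j k) <= M)%N.
  by apply: b_le; have := ltn_ord k; rewrite /bump; lia.
rewrite -[X in _ = _ * z ^+ X](subnK lM) exprD exprVn.
field; exact: expf_neq0.
Qed.

Lemma coef_pair_poly_eq0 n xs b M e :
    (forall j l, (j < n.+2)%N -> (l < n.+2)%N -> j != l ->
       b j + (M - b l) <> e)%N ->
  (pair_poly n xs b M)`_e = 0.
Proof.
move=> no_pair; rewrite coef_sum big1 // => j _.
rewrite coef_sum big1 // => k _.
rewrite coefZ coefXn; case: eqP => [De|]; last by rewrite mulr0.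
case: (no_pair j (bump j k)) => //.
  by have := ltn_ord k; rewrite /bump; lia.
exact: neq_bump.
Qed.

Lemma coef_pair_poly n xs b M j0 l0 : (l0 < j0)%N -> (j0 < n.+2)%N ->
    (forall j l, (j < n.+2)%N -> (l < n.+2)%N -> j != l ->
       b j + (M - b l) = b j0 + (M - b l0) -> j = j0 /\ l = l0)%N ->
  (pair_poly n xs b M)`_(b j0 + (M - b l0)) =
    (-1) ^+ (j0 + l0) * gdet n xs (b \o bump j0 \o bump l0).
Proof.
move=> l_lt j_lt uniq_jl.
have l_lt' : (l0 < n.+1)%N by lia.
have bl : bump j0 l0 = l0 by rewrite /bump; lia.
rewrite coef_sum (bigD1 (Ordinal j_lt)) //=.
rewrite coef_sum (bigD1 (Ordinal l_lt')) //=.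
rewrite coefZ coefXn bl eqxx mulr1.
rewrite [X in _ + X]big1 ?[X in _ + X + _]big1 ?addr0 //.
- move=> k k_neq; rewrite coefZ coefXn.
  case: eqP => [De|]; last by rewrite mulr0.
  have := uniq_jl j0 (bump j0 k) j_lt _ (neq_bump _ _) (esym De).
  case; first by have := ltn_ord k; rewrite /bump; lia.
  move=> _ El; have Ek : k = l0 :> nat.
    by apply: (can_inj (bumpK j0)); rewrite bl.
  by move: k_neq; rewrite -val_eqE /= Ek eqxx.
- move=> j j_neq; rewrite coef_sum big1 // => k _.
  rewrite coefZ coefXn; case: eqP => [De|]; last by rewrite mulr0.
  have := uniq_jl j (bump j k) (ltn_ord j) _ (neq_bump _ _) (esym De).
  case; first by have := ltn_ord k; rewrite /bump; lia.
  by move=> Ej; move: j_neq; rewrite -val_eqE /= Ej eqxx.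
Qed.

Lemma nth_pairs_last zs :
  ((pairs zs)`_(size zs).*2 = 1) * ((pairs zs)`_(size zs).*2.+1 = -1).
Proof. by elim: zs => [|z zs IHzs] /=; split; rewrite ?IHzs. Qed.

(** Subtracting [eps] times the row of 1 from the row of -1 changes nothing; [eps = (-1) ^+ p] then
    removes all columns of parity [p] from the expansion. *)
Lemma gdet_pairs_last zs b (eps : F) :
  gdet (size zs).*2.+2 (pairs zs) b =
  \sum_(j < (size zs).*2.+2) ((-1) ^+ b j - eps) *
     ((-1) ^+ j.+1 * gdet (size zs).*2.+1 (pairs zs) (b \o bump j)).
Proof.
set r := size zs.
(* Replacing the last row by a multiple of the row of the point 1 gives 0. *)
have Z : \sum_(j < r.*2.+2) eps *
    ((-1) ^+ j.+1 * gdet r.*2.+1 (pairs zs) (b \o bump j)) = 0.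
  rewrite -mulr_sumr; apply/eqP; rewrite mulf_eq0; apply/orP; right; apply/eqP.
  pose A := \matrix_(i < r.*2.+2, j < r.*2.+2)
     (if i == ord_max then 1 else (pairs zs)`_i ^+ b j).
  transitivity (\det A).
    rewrite (expand_det_row A ord_max); apply: eq_bigr => j _.
    rewrite !mxE eqxx mul1r /cofactor /gdet /=.
    congr (_ * _); last congr (\det _).
      rewrite -signr_odd -[RHS]signr_odd; congr (_ ^+ nat_of_bool _) => /=.
      by lia.
    apply/matrixP => i k; rewrite !mxE ifF ?lift_max //.
    by apply/negbTE; rewrite eq_sym neq_lift.
  have i_lt : (r.*2 < r.*2.+2)%N by lia.
  rewrite (@determinant_alternate _ _ A (Ordinal i_lt) ord_max) //.
    by rewrite -val_eqE /=; lia.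
  move=> j; rewrite !mxE eqxx; case: ifP => // _.
  by rewrite nth_pairs_last expr1n.
under eq_bigr do rewrite mulrBl.
rewrite sumrB Z subr0 gdet_last; apply: eq_bigr => j _.
rewrite nth_pairs_last; congr (_ * (_ * _)).
by rewrite -signr_odd -[RHS]signr_odd; congr (_ ^+ nat_of_bool _) => /=; lia.
Qed.

End GeneralizedVandermonde.

(** * Vanishing at all nonzero points, and removal of pairs of columns *)

Section Vanishing.
Variable F : numFieldType.
Implicit Types (xs zs : seq F) (b : nat -> nat).

Lemma poly_eq_nonzero (p q : {poly F}) :
  (forall z, z != 0 -> p.[z] = q.[z]) -> p = q.
Proof.
move=> eq_pq; apply/eqP; rewrite -subr_eq0; apply/eqP.
apply: (@roots_geq_poly_eq0 _ _ [seq i.+1%:R | i <- iota 0 (size (p - q))]).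
- apply/allP => _ /mapP[i _ ->].
  by rewrite /root hornerD hornerN eq_pq ?subrr // Num.Theory.pnatr_eq0.
- rewrite map_inj_uniq ?iota_uniq // => i j /eqP.
  by rewrite Num.Theory.eqr_nat => /eqP[].
- by rewrite size_map size_iota.
Qed.

Definition nonzero zs := all (fun z => z != 0) zs.

(* With [m] indeterminates, [n = 2] keeps all the rows and [n = 1] drops the
   row of the point -1. *)
Definition vanishes n m b := forall zs, size zs = m -> nonzero zs ->
  gdet (n + m.*2) (pairs zs) b = 0.

Lemma eq_vanishes n m b b' :
  (forall i, (i < n + m.*2)%N -> b i = b' i) ->
  vanishes n m b -> vanishes n m b'.
Proof. by move=> eq_b b0 zs sz nz; rewrite -(eq_gdet _ eq_b) b0. Qed.

(** With the other points fixed, the pair polynomial vanishes at every nonzero [z], hence is zero; a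
    difference [b j0 - b l0] attained only once isolates a single minor as a coefficient. *)
Lemma vanishes_peel_pair n m b j0 l0 : let N := (n + m.+1.*2)%N in
    (l0 < j0)%N -> (j0 < N)%N ->
    (forall j l, (j < N)%N -> (l < N)%N -> j != l ->
       b j + b l0 = b j0 + b l -> j = j0 /\ l = l0)%N ->
  vanishes n m.+1 b -> vanishes n m (b \o bump j0 \o bump l0).
Proof.
move=> N; rewrite /vanishes -/N.
have {N}-> : N = (n + m.*2).+2 by rewrite /N; lia.
move=> l_lt j_lt uniq_jl b0 zs sz nz.
pose M := (\sum_(i < (n + m.*2).+2) b i)%N.
have b_le i : (i < (n + m.*2).+2)%N -> (b i <= M)%N.
  by move=> iN; rewrite /M (bigD1 (Ordinal iN)) //= leq_addr.
have Q0 : pair_poly (n + m.*2) (pairs zs) b M = 0.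
  apply: poly_eq_nonzero => z z0; rewrite horner0 horner_pair_poly //.
  by rewrite (b0 (z :: zs)) ?mul0r //= ?sz // z0.
have := @coef_pair_poly F (n + m.*2) (pairs zs) b M _ _ l_lt j_lt.
rewrite Q0 coef0 => E; apply/eqP.
suff: (-1) ^+ (j0 + l0) *
    gdet (n + m.*2) (pairs zs) (b \o bump j0 \o bump l0) == 0.
  by rewrite mulf_eq0 signr_eq0.
rewrite -E // => j l jN lN jl Ejl.
apply: uniq_jl => //; have := b_le _ lN; have := b_le _ (ltn_trans l_lt j_lt).
lia.
Qed.

Lemma homo_bump b k :
  {homo b : i j / (i < j)%N} -> {homo b \o bump k : i j / (i < j)%N}.
Proof. by move=> hb i j ij; apply: hb; rewrite /bump; lia. Qed.

Lemma homo_shift b :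
  {homo b : i j / (i < j)%N} -> {homo b \o S : i j / (i < j)%N}.
Proof. by move=> hb i j ij; apply: hb. Qed.

Lemma homo_lt_le b :
  {homo b : i j / (i < j)%N} -> {homo b : i j / (i <= j)%N}.
Proof. by move=> hb i j; rewrite leq_eqVlt => /orP[/eqP->//|/hb/ltnW]. Qed.

(* [b n - b 0] is the largest difference, stated without truncated
   subtraction. *)
Lemma spread_uniq b n j l : {homo b : i j / (i < j)%N} ->
  (j <= n)%N -> (b n + b l <= b j + b 0)%N -> (j = n /\ l = 0)%N.
Proof.
move=> hb jn E; have hb' := homo_lt_le hb.
have := hb' 0%N l isT; have := hb' j n jn => b1 b2.
split.
  by case: (ltngtP j n) => // [/hb|]; lia.
by case: l E b2 => // l E b2; have := hb 0%N l.+1 isT; lia.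
Qed.

Lemma vanishes_peel_ends n m b : {homo b : i j / (i < j)%N} ->
  vanishes n m.+1 b -> vanishes n m (b \o S).
Proof.
move=> hb /(@vanishes_peel_pair n m b (n + m.*2).+1 0%N isT) => H.
apply: eq_vanishes (H _ _); [|lia|].
  by move=> i iN; rewrite /= /bump; congr b; lia.
by move=> j l jN lN jl E; apply: (@spread_uniq b) => //; lia.
Qed.

Lemma homo_lt_inj b : {homo b : i j / (i < j)%N} -> injective b.
Proof. by move=> hb i j E; case: (ltngtP i j) => // /hb; lia. Qed.

(** The gap says that [b (n + m.*2).+1 - b 1] beats its rival [b (n + m.*2) - b 0], so it is the
    second largest difference and is attained once. *)
Lemma vanishes_peel_high n m b : {homo b : i j / (i < j)%N} -> (0 < n)%N ->
    (b (n + m.*2) + b 1 < b (n + m.*2).+1 + b 0)%N ->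
  vanishes n m.+1 b -> vanishes n m (b \o bump 1).
Proof.
move=> hb n_gt0 gap.
move=> /(@vanishes_peel_pair n m b (n + m.*2).+1 1%N) H.
apply: eq_vanishes (H _ _ _); [|lia|lia|].
  by move=> i iN; rewrite /= /bump; congr b; lia.
move=> j l jN lN jl E; have hb' := homo_lt_le hb.
have jE : j = (n + m.*2).+1.
  case: (leqP j (n + m.*2)) => [/hb' bj|]; last by lia.
  by have := hb' 0%N l isT; lia.
by split=> //; apply: (homo_lt_inj hb); move: E; rewrite jE; lia.
Qed.

Lemma vanishes_peel_low n m b : {homo b : i j / (i < j)%N} -> (0 < n)%N ->
    (b (n + m.*2).+1 + b 0 < b (n + m.*2) + b 1)%N ->
  vanishes n m.+1 b -> vanishes n m (b \o bump (n + m.*2) \o S).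
Proof.
move=> hb n_gt0 gap.
move=> /(@vanishes_peel_pair n m b (n + m.*2) 0%N) H.
apply: eq_vanishes (H _ _ _) => //; [lia|lia|].
move=> j l jN lN jl E; have hb' := homo_lt_le hb.
have lE : l = 0%N.
  case: l lN jl E => // l lN jl E.
  have := hb' 1%N l.+1 isT; have := hb' j (n + m.*2).+1; lia.
by split=> //; apply: (homo_lt_inj hb); move: E; rewrite lE; lia.
Qed.

(** Peeling the extreme pair [m] times leaves the 1 by 1 determinant of the point 1, which is 1. *)
Lemma not_vanishes1 m b : {homo b : i j / (i < j)%N} -> ~ vanishes 1 m b.
Proof.
elim: m b => [|m IHm] b hb.
  move=> /(_ [::] erefl isT) /eqP; rewrite /gdet det_mx11 mxE /= expr1n.
  by rewrite oner_eq0.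
by move/(vanishes_peel_ends hb)/IHm; apply; apply: homo_shift.
Qed.

(** * Comparison of determinants without the row of -1 *)

Definition agree n m b b' := forall zs, size zs = m -> nonzero zs ->
  gdet (n + m.*2) (pairs zs) b = gdet (n + m.*2) (pairs zs) b'.

Lemma agree_sym n m b b' : agree n m b b' -> agree n m b' b.
Proof. by move=> bb' zs sz nz; rewrite bb'. Qed.

Lemma agree_pair_poly n m b b' zs M : agree n m.+1 b b' ->
    size zs = m -> nonzero zs ->
    (forall i, (i < (n + m.*2).+2)%N -> (b i <= M)%N) ->
    (forall i, (i < (n + m.*2).+2)%N -> (b' i <= M)%N) ->
  pair_poly (n + m.*2) (pairs zs) b M = pair_poly (n + m.*2) (pairs zs) b' M.
Proof.
move=> bb' sz nz b_le b'_le; apply: poly_eq_nonzero => z z0.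
rewrite !horner_pair_poly //; congr (_ * _).
have := bb' (z :: zs); rewrite doubleS !addnS; apply=> //=; first by rewrite sz.
by rewrite z0.
Qed.

(** Were the spread of [b] larger, the polynomial of [b'] would have no term in the top degree of
    that of [b], so the determinant of the interior [b \o S] would vanish, against
    [not_vanishes1]. *)
Lemma agree1_spread_le m b b' :
    {homo b : i j / (i < j)%N} -> {homo b' : i j / (i < j)%N} ->
    agree 1 m.+1 b b' ->
  (b m.+1.*2 + b' 0 <= b' m.+1.*2 + b 0)%N.
Proof.
move=> hb hb' bb'; rewrite leqNgt; apply/negP => gap.
have lb := homo_lt_le hb; have lb' := homo_lt_le hb'.
case: (@not_vanishes1 m (b \o S)); first exact: homo_shift.
move=> zs sz nz; pose M := (b m.+1.*2 + b' m.+1.*2)%N.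
have := @coef_pair_poly F (1 + m.*2) (pairs zs) b M m.+1.*2 0%N.
rewrite (agree_pair_poly bb') //; last 2 first.
- by move=> i iN; have := lb i m.+1.*2; rewrite /M; lia.
- by move=> i iN; have := lb' i m.+1.*2; rewrite /M; lia.
rewrite coef_pair_poly_eq0; last first.
  move=> j l jN lN jl E; have := lb' j m.+1.*2; have := lb' 0%N l.
  by have := lb' l m.+1.*2; have := lb 0%N m.+1.*2; rewrite /M in E; lia.
move=> E; apply/eqP.
rewrite -(@eq_gdet F _ _ (b \o bump m.+1.*2 \o bump 0)); last first.
  by move=> i iN; rewrite /= /bump; congr b; lia.
suff: (-1) ^+ (m.+1.*2 + 0) *
    gdet (1 + m.*2) (pairs zs) (b \o bump m.+1.*2 \o bump 0) == 0.
  by rewrite mulf_eq0 signr_eq0.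
rewrite -E //.
move=> j l jN lN jl Ejl; apply: (@spread_uniq b) => //.
have := lb l m.+1.*2; have := lb 0%N m.+1.*2; rewrite /M in Ejl; lia.
Qed.

(** The spreads being equal, both top coefficients sit in the same degree; up to a common sign they
    are the determinants of the interiors. *)
Lemma agree1_peel m b b' :
    {homo b : i j / (i < j)%N} -> {homo b' : i j / (i < j)%N} ->
  agree 1 m.+1 b b' -> agree 1 m (b \o S) (b' \o S).
Proof.
move=> hb hb' bb' zs sz nz.
have lb := homo_lt_le hb; have lb' := homo_lt_le hb'.
have le1 := agree1_spread_le hb hb' bb'.
have le2 := agree1_spread_le hb' hb (agree_sym bb').
pose M := (b m.+1.*2 + b' m.+1.*2)%N.
have top (c : nat -> nat) : {homo c : i j / (i < j)%N} -> (c m.+1.*2 <= M)%N ->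
   (pair_poly (1 + m.*2) (pairs zs) c M)`_(c m.+1.*2 + (M - c 0))%N =
     (-1) ^+ (m.+1.*2 + 0) * gdet (1 + m.*2) (pairs zs) (c \o S).
  move=> hc cM; have lc := homo_lt_le hc.
  rewrite coef_pair_poly //; last first.
    move=> j l jN lN jl Ejl; apply: (@spread_uniq c) => //.
    by have := lc l m.+1.*2; have := lc 0%N m.+1.*2; lia.
  congr (_ * _); apply: eq_gdet => i iN; rewrite /= /bump; congr c; lia.
have := top b hb; rewrite (agree_pair_poly bb') //; last 2 first.
- by move=> i iN; have := lb i m.+1.*2; rewrite /M; lia.
- by move=> i iN; have := lb' i m.+1.*2; rewrite /M; lia.
have -> : (b m.+1.*2 + (M - b 0) = b' m.+1.*2 + (M - b' 0))%N.
  by have := lb 0%N m.+1.*2; have := lb' 0%N m.+1.*2; rewrite /M; lia.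
rewrite top ?leq_addl // => /(_ (leq_addr _ _)) /(mulfI _) -> //.
by rewrite signr_eq0.
Qed.

Lemma agree1_spreads m b b' i :
    {homo b : i j / (i < j)%N} -> {homo b' : i j / (i < j)%N} ->
    agree 1 m b b' -> (i <= m.*2)%N ->
  (b (m.*2 - i) + b' i = b' (m.*2 - i) + b i)%N.
Proof.
elim: m b b' i => [|m IHm] b b' i hb hb' bb' im.
  by move: im; rewrite leqn0 => /eqP->; apply: addnC.
have le1 := agree1_spread_le hb hb' bb'.
have le2 := agree1_spread_le hb' hb (agree_sym bb').
case: i im => [|i] im; first by rewrite subn0; lia.
(* Here the extreme pair is read backwards. *)
have [->|i_neq] := eqVneq i.+1 m.+1.*2; first by rewrite subnn; lia.
have := IHm _ _ i (homo_shift hb) (homo_shift hb') (agree1_peel hb hb' bb').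
have -> : (m.+1.*2 - i.+1 = (m.*2 - i).+1)%N by lia.
move=> /= H; apply: H; lia.
Qed.

(** * Classification of the exponents with vanishing determinant *)

Definition same_parity n b := exists p, forall i, (i < n)%N -> odd (b i) = p.

(** For the beta-numbers of a self-complementary partition of width [w] the sum is [w + n - 1]; [n]
    being even in the application, odd width means even sum. *)
Definition even_symmetric n b := exists h,
  forall i, (i < n)%N -> (b i + b (n - i.+1) = h.*2)%N.

Lemma signr_sub_neq0 i (p : bool) :
  odd i != p -> (-1) ^+ i - (-1) ^+ p != 0 :> F.
Proof.
rewrite -signr_odd; case: odd; case: p => //= _; rewrite ?expr0 ?expr1.
  by rewrite -opprD oppr_eq0 (Num.Theory.pnatr_eq0 _ 2).
by rewrite opprK (Num.Theory.pnatr_eq0 _ 2).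
Qed.

Lemma vanishes2_expand m b (eps : F) zs :
    vanishes 2 m b -> size zs = m -> nonzero zs ->
  \sum_(j < m.*2.+2) ((-1) ^+ b j - eps) *
     ((-1) ^+ j.+1 * gdet m.*2.+1 (pairs zs) (b \o bump j)) = 0.
Proof. by move=> b0 sz nz; rewrite -sz -gdet_pairs_last sz; apply: b0. Qed.

(** With [eps = (-1) ^+ p] only column [j0] survives, with factor 2 up to sign, so its minor without
    the row of -1 would vanish. *)
Lemma vanishes2_one_odd m b (p : bool) j0 : {homo b : i j / (i < j)%N} ->
    (j0 < m.*2.+2)%N ->
    (forall i, (i < m.*2.+2)%N -> odd (b i) = p (+) (i == j0)) ->
  ~ vanishes 2 m b.
Proof.
move=> hb j0N par b0; apply: (@not_vanishes1 m (b \o bump j0)).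
  exact: homo_bump.
move=> zs sz nz; have := vanishes2_expand ((-1) ^+ p) b0 sz nz.
rewrite (bigD1 (Ordinal j0N)) //= big1 => [|i]; last first.
  rewrite -val_eqE /= => /negPf ij.
  by rewrite -signr_odd par // ij addbF subrr mul0r.
move/eqP; rewrite addr0 !mulf_eq0 signr_eq0 (negPf (signr_sub_neq0 _)) /=.
  by move/eqP.
by rewrite par // eqxx addbT; case: (p).
Qed.

(** Only the two extreme columns survive the expansion, so deleting either one gives the same
    determinant without the row of -1. *)
Lemma vanishes2_two_odd m b (p : bool) : {homo b : i j / (i < j)%N} ->
    (forall i, (i < m.*2.+2)%N ->
       odd (b i) = p (+) ((i == 0) || (i == m.*2.+1))) ->
  vanishes 2 m b -> even_symmetric m.*2.+2 b.
Proof.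
move=> hb par b0.
have bb : agree 1 m (b \o S) b.
  move=> zs sz nz; have := vanishes2_expand ((-1) ^+ p) b0 sz nz.
  rewrite big_ord_recl big_ord_recr /= big1 => [|i _]; last first.
    rewrite -signr_odd par ?lift0 /=; last first.
      by have := ltn_ord i; rewrite /bump; lia.
    have -> : (bump 0 i == m.*2.+1) = false.
      by have := ltn_ord i; rewrite /bump; lia.
    by rewrite addbF subrr mul0r.
  have -> : bump 0 m.*2 = m.*2.+1 by [].
  rewrite -(signr_odd _ (b 0%N)) -(signr_odd _ (b m.*2.+1)) !par //.
  rewrite eqxx orbT addbT add0r.
  have np : (-1) ^+ (~~ p) - (-1) ^+ p != 0 :> F.
    by apply: signr_sub_neq0; case: (p).
  rewrite -mulrDr => /eqP; rewrite mulf_eq0 (negPf np).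
  rewrite /= expr1 mulN1r -signr_odd.
  have -> : odd m.*2.+2 = false by lia.
  rewrite mul1r addrC subr_eq0 eq_sym => /eqP E.
  rewrite (@eq_gdet F _ _ _ (b \o bump 0)); last by move=> i; rewrite /= /bump.
  rewrite E; apply: eq_gdet => i iN; rewrite /= /bump /=; congr b; lia.
(* Equal nested differences of [b \o S] and [b] make consecutive symmetric sums equal. *)
have step i : (i <= m.*2)%N ->
    (b i + b (m.*2.+1 - i) = b i.+1 + b (m.*2 - i))%N.
  move=> im; have := agree1_spreads (homo_shift hb) hb bb im => /=.
  by rewrite subSn //; lia.
have const i : (i <= m.*2.+1)%N ->
    (b i + b (m.*2.+1 - i) = b 0 + b m.*2.+1)%N.
  elim: i => [|i IHi] im; first by rewrite subn0.
  by rewrite subSS -step ?IHi //; lia.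
exists (b 0 + b m.*2.+1)./2 => i iN; rewrite subSS const //.
rewrite halfK oddD !par // !eqxx orbT /=.
by case: (p); rewrite /= subn0.
Qed.

Lemma vanishes2_interior m b (p : bool) : {homo b : i j / (i < j)%N} ->
    (forall i, (0 < i <= m.*2)%N -> odd (b i) = p) ->
    vanishes 2 m b ->
  same_parity m.*2.+2 b \/ even_symmetric m.*2.+2 b.
Proof.
move=> hb par b0.
have parE i : (i < m.*2.+2)%N -> [\/ i = 0%N, i = m.*2.+1 | odd (b i) = p].
  move=> iN; have [->|i0] := eqVneq i 0%N; first by constructor 1.
  have [->|i1] := eqVneq i m.*2.+1; first by constructor 2.
  by constructor 3; apply: par; lia.
have [p0|p0] := eqVneq (odd (b 0%N)) p;
  have [p1|p1] := eqVneq (odd (b m.*2.+1)) p.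
- by left; exists p => i /parE[->|->|].
- case: (@vanishes2_one_odd m b p m.*2.+1 hb _ _ b0) => // i iN.
  have [->|i1] := eqVneq i m.*2.+1; first by case: odd p1; case: (p).
  by case: (parE i iN) i1 => [->|->|]; rewrite ?eqxx // ?addbF.
- case: (@vanishes2_one_odd m b p 0%N hb _ _ b0) => // i iN.
  have [->|i1] := eqVneq i 0%N; first by case: odd p0; case: (p).
  by case: (parE i iN) i1 => [->|->|]; rewrite ?eqxx // ?addbF.
- right; apply: (@vanishes2_two_odd m b p) => // i iN.
  have [->|i0] := eqVneq i 0%N; first by case: odd p0; case: (p).
  have [->|i1] := eqVneq i m.*2.+1; first by case: odd p1; case: (p).
  by case: (parE i iN) i0 i1 => [->|->|]; rewrite ?eqxx // ?addbF.
Qed.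

Lemma vanishes2_cases m b : {homo b : i j / (i < j)%N} -> vanishes 2 m b ->
  same_parity m.*2.+2 b \/ even_symmetric m.*2.+2 b.
Proof.
elim: m b => [|m IHm] b hb b0.
  (* The interior is empty, so its parity is arbitrary. *)
  by apply: (@vanishes2_interior 0 b true) => // i; lia.
(* Two exponents with even sum have the same parity; so symmetry may be taken with [0 < m], where
   [b 2] and [b m.*2.+1] survive a second peeling as a symmetric pair. *)
have IH c : {homo c : i j / (i < j)%N} -> vanishes 2 m c ->
    same_parity m.*2.+2 c \/ (0 < m)%N /\ even_symmetric m.*2.+2 c.
  move=> hc /IHm-/(_ hc)[|[h hS]]; first by left.
  case: (posnP m) => [m0|]; last by right; split=> //; exists h.
  left; exists (odd (c 0%N)) => i; rewrite m0 in hS *.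
  have /(congr1 odd) : (c 0 + c 1 = h.*2)%N by rewrite -(hS 0%N).
  rewrite oddD odd_double; case: i => [|[|]] // + _.
  by do 2!case: odd.
have mid0 := vanishes_peel_ends hb b0.
case: (IH _ (homo_shift hb) mid0) => [[p par]|[m0 [h sym]]].
  apply: (@vanishes2_interior m.+1 b p) => // -[//|i] iN.
  by apply: par; lia.
have sym' i : (0 < i <= m.*2.+2)%N -> (b i + b (m.*2.+3 - i) = h.*2)%N.
  case: i => // i iN; rewrite -(sym i) /=; last by lia.
  by congr (_ + b _)%N; lia.
have s1 := sym' 1%N isT; rewrite subn1 /= in s1.
have s2 := sym' 2%N isT; rewrite subn2 /= in s2.
(* The interior is symmetric with sum [h.*2]. If the extreme sum differs, removing another pair
   leaves exponents of one parity or again symmetric ones. *)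
case: (ltngtP (b 0%N + b m.*2.+3) h.*2) => cmp.
- have b_lt := hb m.*2.+2 m.*2.+3 (leqnn _).
  have hc := homo_shift (homo_bump (2 + m.*2) hb).
  have gap : (b (2 + m.*2).+1 + b 0 < b (2 + m.*2) + b 1)%N.
    by rewrite addnC [ltnRHS]addnC s1.
  have c0 := @vanishes_peel_low 2 m b hb isT gap b0.
  case: (IH _ hc c0) => [[p par]|[_ [h' sym2]]].
    apply: (@vanishes2_interior m.+1 b p) => // i iN.
    (* The removed exponent [b m.*2.+2] has the parity of [b 1], their sum being [h.*2]. *)
    have [->|i_neq] := eqVneq i m.*2.+2.
      have <- : odd (b 1%N) = p.
        by rewrite -(par 0%N isT) /=; congr (odd (b _)); rewrite /bump; lia.
      by move/(congr1 odd): s1; rewrite oddD odd_double; do 2!case: odd.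
    rewrite -(par i.-1); last by lia.
    by rewrite /= /bump; congr (odd (b _)); lia.
  (* The pair [b 2], [b m.*2.+1] forces [h' = h], whence [b m.*2.+3 = b m.*2.+2], a
     contradiction. *)
  have E0 : (b 1 + b m.*2.+3 = h'.*2)%N.
    by rewrite -(sym2 0%N isT) /=; congr (b _ + b _)%N; rewrite /bump; lia.
  have E1 : (b 2 + b m.*2.+1 = h'.*2)%N.
    by rewrite -(sym2 1%N isT) /=; congr (b _ + b _)%N; rewrite /bump; lia.
  by lia.
- have b_lt := hb 0%N 1%N isT.
  have hc := homo_bump 1 hb.
  have gap : (b (2 + m.*2) + b 1 < b (2 + m.*2).+1 + b 0)%N.
    by rewrite addnC [ltnRHS]addnC s1.
  have c0 := @vanishes_peel_high 2 m b hb isT gap b0.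
  case: (IH _ hc c0) => [[p par]|[_ [h' sym2]]].
    apply: (@vanishes2_interior m.+1 b p) => // i iN.
    have [->|i_neq] := eqVneq i 1%N.
      have <- : odd (b m.*2.+2) = p.
        by rewrite -(par m.*2.+1 (leqnn _)).
      by move/(congr1 odd): s1; rewrite oddD odd_double; do 2!case: odd.
    rewrite -(par i.-1); last by lia.
    by rewrite /= /bump; congr (odd (b _)); lia.
  have E0 : (b 0 + b m.*2.+2 = h'.*2)%N.
    by rewrite -(sym2 0%N isT) /=; congr (b _ + b _)%N; rewrite /bump; lia.
  have E1 : (b 2 + b m.*2.+1 = h'.*2)%N.
    by rewrite -(sym2 1%N isT) /=; congr (b _ + b _)%N; rewrite /bump; lia.
  by lia.
- right; exists h => i iN; have [->|i0] := eqVneq i 0%N.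
    by rewrite -cmp; congr (_ + b _)%N; lia.
  have [->|i1] := eqVneq i m.*2.+3.
    by rewrite -cmp addnC; congr (b _ + b _)%N; lia.
  by rewrite -(sym' i) //; lia.
Qed.

End Vanishing.

(** * From indeterminates to rational points *)

(* The row of [x^-1] multiplied by [x ^+ M], so as to clear denominators. *)
Definition pairs_num (R : comNzRingType) (xs : seq R) M i e : R :=
  if (i < (size xs).*2)%N then
    if odd i then xs`_i./2 ^+ (M - e) else xs`_i./2 ^+ e
  else if i == (size xs).*2 then 1 else (-1) ^+ e.

Definition pairs_den (R : comNzRingType) (xs : seq R) M i : R :=
  if (i < (size xs).*2)%N && odd i then xs`_i./2 ^+ M else 1.

Lemma rmorph_pairs_num (R S : comNzRingType) (f : {rmorphism R -> S})
    (xs : seq R) M i e :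
  f (pairs_num xs M i e) = pairs_num (map f xs) M i e.
Proof.
rewrite /pairs_num size_map; case: ifP => [i_lt|_].
  by case: ifP => _; rewrite rmorphXn (nth_map 0) ?ltn_half_double.
by case: ifP => _; rewrite ?rmorph1 // rmorphXn rmorphN rmorph1.
Qed.

Lemma pairs_den_neq0 (F : fieldType) (zs : seq F) M i :
  all (fun z => z != 0) zs -> pairs_den zs M i != 0.
Proof.
move=> /all_nthP nz; rewrite /pairs_den; case: ifP => [/andP[i_lt _]|_].
  by rewrite expf_neq0 //; apply: nz; rewrite ltn_half_double.
exact: oner_neq0.
Qed.

Lemma pairs_numE (F : fieldType) (zs : seq F) M i e :
    all (fun z => z != 0) zs -> (e <= M)%N -> (i < (size zs).*2.+2)%N ->
  (pairs zs)`_i ^+ e * pairs_den zs M i = pairs_num zs M i e.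
Proof.
move=> + eM; elim: zs i => [|z zs IHzs] i /=.
  by move=> _; case: i => [|[|]] // _; rewrite ?expr1n mulr1.
case/andP => z0 nz; case: i => [|[|i]] iN; rewrite /pairs_num /pairs_den /=.
- by rewrite mulr1.
- by rewrite expfB_cond ?(negPf z0) // exprVn mulrC.
have := IHzs i nz iN; rewrite /pairs_num /pairs_den negbK.
by rewrite !doubleS !ltnS eqSS.
Qed.

Lemma det_pairs_num (F : fieldType) (zs : seq F) M (b : nat -> nat) :
    all (fun z => z != 0) zs ->
    (forall i, (i < (size zs).*2.+2)%N -> (b i <= M)%N) ->
  \det (\matrix_(i < (size zs).*2.+2, j < (size zs).*2.+2)
          pairs_num zs M i (b j)) =
  (\prod_(i < (size zs).*2.+2) pairs_den zs M i) *
    gdet (size zs).*2.+2 (pairs zs) b.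
Proof.
move=> nz bM; pose d := \row_(i < (size zs).*2.+2) pairs_den zs M i.
rewrite (eq_bigr (fun i => d 0 i)) => [|i _]; last by rewrite mxE.
rewrite -det_diag -det_mulmx mul_diag_mx; congr (\det _).
by apply/matrixP => i j; rewrite !mxE mulrC pairs_numE ?bM.
Qed.

Lemma indet_neq0 r (k : 'I_r) : indet k != 0.
Proof.
rewrite /indet tofrac_eq0; apply/eqP => /(congr1 (mmap intr (fun=> 1 : int))).
by rewrite mmapX mmap1U mmap0 => /eqP; rewrite oner_eq0.
Qed.

(** With denominators cleared the determinant lies in [{mpoly int[r]}], where it is zero because its
    image in the fraction field is; it can then be evaluated at nonzero rationals. *)
Lemma gdet_indet_vanishes r (b : nat -> nat) :
    gdet r.*2.+2 (pairs [seq indet k | k <- enum 'I_r]) b = 0 ->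
  vanishes rat 2 r b.
Proof.
pose Xs : seq {mpoly int[r]} := [seq 'X_k | k <- enum 'I_r].
have sX : size Xs = r by rewrite size_map size_enum_ord.
have -> : [seq indet k | k <- enum 'I_r] = map (@FracField.tofrac _) Xs.
  by rewrite /Xs -[RHS]map_comp; apply: eq_map.
set Ks := map _ Xs => det0 zs sz nz.
have sK : size Ks = r by rewrite size_map.
pose M := (\sum_(i < r.*2.+2) b i)%N.
have bM i : (i < r.*2.+2)%N -> (b i <= M)%N.
  by move=> iN; rewrite /M (bigD1 (Ordinal iN)) //= leq_addr.
have nzK : all (fun z => z != 0) Ks.
  rewrite /Ks /Xs -[map _ _]map_comp all_map.
  by apply/allP => k _; apply: indet_neq0.
pose P := \matrix_(i < r.*2.+2, j < r.*2.+2) pairs_num Xs M i (b j).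
have P0 : \det P = 0.
  apply/eqP; rewrite -tofrac_eq0 -det_map_mx.
  have := @det_pairs_num _ Ks M b nzK; rewrite sK => /(_ bM).
  rewrite det0 mulr0 => <-; apply/eqP; congr (\det _).
  by apply/matrixP => i j; rewrite !mxE rmorph_pairs_num.
pose ev : {rmorphism {mpoly int[r] } -> rat} :=
  mmap (intr : int -> rat) (fun k : 'I_r => zs`_k).
have evX : map ev Xs = zs.
  apply: (@eq_from_nth _ 0); first by rewrite size_map sX.
  rewrite size_map sX => i ir.
  rewrite -map_comp (nth_map (Ordinal ir)) ?size_enum_ord //=.
  by rewrite /ev mmapX mmap1U nth_enum_ord.
have := @det_pairs_num _ zs M b nz; rewrite sz => /(_ bM) /eqP.
have -> : \matrix_(i < r.*2.+2, j < r.*2.+2) pairs_num zs M i (b j) =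
    map_mx ev P.
  by apply/matrixP => i j; rewrite !mxE rmorph_pairs_num evX.
rewrite det_map_mx P0 rmorph0 eq_sym mulf_eq0 => /orP[/prodf_eq0[i _]|/eqP//].
by rewrite (negPf (pairs_den_neq0 _ _ nz)).
Qed.

(** * The Schur polynomial at the given points as a determinant *)

Definition points_det r (e : 'I_(r.*2.+2) -> nat) : ratfun r :=
  \det (\matrix_(i < r.*2.+2, j < r.*2.+2) tnth (points r) i ^+ e j).

(** Permuting rows and columns costs a sign: [points] begins with 1 and -1 while [pairs] ends with
    them, and beta-numbers decrease while [b] is to increase. *)
Lemma points_det_rev_eq0 r (b : nat -> nat) :
  points_det (fun j : 'I_(r.*2.+2) => b (rev_ord j)) = 0 ->
  vanishes rat 2 r b.
Proof.
move=> A0; apply: gdet_indet_vanishes.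
set Ks := [seq _ | _ <- _].
have /tuple_permP[s Es] : perm_eq (pairs Ks) (points r).
  rewrite /= /points_seq perm_catC; apply: perm_cat => //.
  by rewrite /Ks -map_comp.
pose A := \matrix_(i < r.*2.+2, j < r.*2.+2)
  tnth (points r) i ^+ b (rev_ord j).
have -> : gdet r.*2.+2 (pairs Ks) b =
    \det (row_perm s (col_perm (perm (@rev_ord_inj _)) A)).
  congr (\det _); apply/matrixP => i j; rewrite !mxE permE rev_ordK Es.
  by rewrite -(tnth_nth 0 (mktuple _)) tnth_mktuple.
rewrite row_permE col_permE !det_mulmx.
by rewrite [\det A]A0 mul0r mulr0.
Qed.

(** The classification itself excludes a zero denominator: the exponents 0, 1, 2, ... have both
    parities and odd symmetric sums. *)
Lemma points_det_staircase_neq0 r : points_det (@staircase r.*2.+2) != 0.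
Proof.
apply/eqP => /(@points_det_rev_eq0 r id) /vanishes2_cases.
case=> // [[p par]|[h sym]].
  by have := par 1%N isT; rewrite -(par 0%N isT).
by have := sym 0%N isT; lia.
Qed.

Lemma mmap_alternant (R : comNzRingType) n (e : 'I_n -> nat) (x : 'I_n -> R) :
  mmap intr x (alternant e) = \det (\matrix_(i < n, j < n) x i ^+ e j).
Proof.
rewrite /alternant -det_map_mx; congr (\det _).
by apply/matrixP => i j; rewrite !mxE rmorphXn /= mmapX mmap1U.
Qed.

Lemma eval_schur_eq0 r (lambda : r.*2.+2.-tuple nat) :
  (eval_schur lambda (points r) == 0) = (points_det (beta lambda) == 0).
Proof.
rewrite /points_det -mmap_alternant -schurP rmorphM mulf_eq0.
have := points_det_staircase_neq0 r.
by rewrite /points_det -mmap_alternant => /negPf->; rewrite orbF.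
Qed.

(** * Sufficiency of the two conditions *)

Lemma det_row_scale_eq0 (F : fieldType) n (A : 'M[F]_n) i j c :
  i != j -> row i A = c *: row j A -> \det A = 0.
Proof.
move=> ij Eij; apply/eqP/det0P.
exists (delta_mx 0 i - c *: delta_mx 0 j).
  apply/eqP => /matrixP/(_ 0 i); rewrite !mxE !eqxx (negPf ij) mulr0 subr0.
  by move/eqP; rewrite oner_eq0.
by rewrite mulmxBl -scalemxAl -!rowE Eij subrr.
Qed.

Lemma points_det_same_parity r (e : 'I_(r.*2.+2) -> nat) (p : bool) :
  (forall j, odd (e j) = p) -> points_det e = 0.
Proof.
move=> par; pose i1 : 'I_(r.*2.+2) := Ordinal (isT : 1 < r.*2.+2)%N.
apply: (@det_row_scale_eq0 _ _ _ i1 ord0 ((-1) ^+ p)) => //.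
apply/matrixP => i j; rewrite !mxE !(tnth_nth 0) /=.
by rewrite expr1n mulr1 -(signr_odd _ (e j)) par.
Qed.

Lemma expr_inv_antisym (F : fieldType) (x : F) m n : x != 0 ->
  - ((x^-1 ^+ m - x^-1 ^+ n) * x ^+ (m + n)) = x ^+ m - x ^+ n.
Proof. by move=> x0; rewrite exprD !exprVn; field; rewrite !expf_neq0. Qed.

(* A function [x |-> x^(e j) - x^(e (rev j))] takes, up to a unit, opposite
   values at [z] and [z^-1] and vanishes at [1] and [-1]; hence the [r + 1]
   functions of this kind are dependent on the points. *)
Lemma points_det_even_symmetric r (e : 'I_(r.*2.+2) -> nat) h :
    (forall j, e j + e (rev_ord j) = h.*2)%N ->
  points_det e = 0.
Proof.
move=> sym; have le_r : (r.+1 <= r.*2.+2)%N by lia.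
pose w (j : 'I_r.+1) := widen_ord le_r j.
pose c j (x : ratfun r) := x ^+ e (w j) - x ^+ e (rev_ord (w j)).
pose W := \matrix_(j < r.+1, k < r) c j (indet k).
(* [W] has [r + 1] rows and rank at most [r]. *)
have [a] : exists2 a : 'rV_r.+1, (a <= kermx W)%MS & a != 0.
  apply/rowV0Pn; rewrite kermx_eq0 /row_free.
  by have := rank_leq_col W; case: eqP => // ->; rewrite ltnn.
move=> /sub_kermxP aW0 a0.
have ker k : \sum_j a 0 j * c j (indet k) = 0.
  have /matrixP/(_ 0 k) := aW0; rewrite !mxE => E; rewrite -[RHS]E.
  by apply: eq_bigr => j _; rewrite mxE.
(* Row [j] holds the coefficients of [c j] on the columns, so [a *m E] is a relation between
   columns. *)
pose E := \matrix_(j < r.+1, l < r.*2.+2)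
  ((l == w j)%:R - (l == rev_ord (w j))%:R : ratfun r).
have kerP x : x \in points_seq r -> \sum_j a 0 j * c j x = 0.
  have par j : odd (e (w j)) = odd (e (rev_ord (w j))).
    by have /(congr1 odd) := sym (w j); rewrite oddD odd_double; do 2!case: odd.
  rewrite !inE => /or3P[/eqP->|/eqP->|/flattenP[_ /mapP[k _ ->]]].
  - by apply: big1 => j _; rewrite /c !expr1n subrr mulr0.
  - apply: big1 => j _; rewrite /c -signr_odd par signr_odd.
    by rewrite subrr mulr0.
  rewrite !inE => /orP[/eqP->|/eqP->]; first exact: ker.
  have k0 := indet_neq0 k.
  (* Multiplication by the unit [z ^+ h.*2] turns the value at [z^-1] into minus the value at
     [z]. *)
  apply/eqP; rewrite -(mulIr_eq0 _ (mulIf (expf_neq0 h.*2 k0))) -oppr_eq0.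
  rewrite mulr_suml -sumrN -[X in _ == X](ker k); apply/eqP.
  apply: eq_bigr => j _; rewrite -mulrA -mulrN /c; congr (_ * _).
  by rewrite -(sym (w j)) expr_inv_antisym.
rewrite /points_det -det_tr; apply/eqP/det0P; exists (a *m E).
  (* The indices [w j] and [rev_ord (w k)] lie in opposite halves, so the entry of [a *m E] at [w j]
     is that of [a] at [j]. *)
  apply: contra a0 => /eqP/matrixP aE0; apply/eqP/matrixP => i j.
  have := aE0 i (w j); rewrite !mxE (bigD1 j) //= !mxE eqxx.
  rewrite big1 => [|k kj]; last first.
    rewrite !mxE -!val_eqE /=; have := ltn_ord k; have := ltn_ord j => jr kr.
    have -> : (j == k :> nat) = false by move: kj; rewrite -val_eqE /=; lia.
    have -> : (j == r.*2.+2 - k.+1 :> nat)%N = false by lia.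
    by rewrite subrr mulr0.
  rewrite -val_eqE /=; have jr := ltn_ord j.
  have -> : (j == r.*2.+2 - j.+1 :> nat)%N = false by lia.
  by rewrite subr0 mulr1 addr0.
apply/matrixP => z i; rewrite -mulmxA !mxE (ord1 z).
rewrite -[RHS](kerP (tnth (points r) i)) ?mem_tnth //; apply: eq_bigr => j _.
rewrite mxE /c; congr (_ * _).
have sum1 (k : 'I_(r.*2.+2)) : \sum_l (l == k)%:R * tnth (points r) i ^+ e l =
    tnth (points r) i ^+ e k.
  rewrite (bigD1 k) //= eqxx mul1r big1 ?addr0 // => l /negPf->.
  by rewrite mul0r.
rewrite -!sum1 -sumrB; apply: eq_bigr => l _.
by rewrite !mxE mulrBl.
Qed.

Theorem theorem8p6 (r : nat) (r_gt0 : (1 <= r)%N)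
    (lambda : (r.*2.+2).-tuple nat) (lambda_part : is_part lambda) :
  eval_schur lambda (points r) = 0
  <->
  ((forall j : 'I_(r.*2.+2), ~~ odd (beta lambda j))
   \/ (forall j : 'I_(r.*2.+2), odd (beta lambda j)))
  \/ (exists w : nat, odd w /\
        forall i : 'I_(r.*2.+2),
          (tnth lambda i + tnth lambda (rev_ord i))%N = w).
Proof.
(* The beta-numbers in increasing order. *)
pose b i := (nth 0 lambda (r.*2.+1 - i) + i)%N.
have bE (j : 'I_(r.*2.+2)) : b (rev_ord j) = beta lambda j.
  rewrite /b /beta (tnth_nth 0%N) /=; congr (nth _ _ _ + _)%N.
  by have := ltn_ord j; lia.
have rev_beta (j : 'I_(r.*2.+2)) : (beta lambda j + beta lambda (rev_ord j) =
    tnth lambda j + tnth lambda (rev_ord j) + r.*2.+1)%N.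
  by rewrite /beta /=; have := ltn_ord j; lia.
have hb : {homo b : i j / (i < j)%N}.
  have geq_trans : transitive geq by move=> y x z /= yx zy; apply: leq_trans yx.
  move=> i j ij; have := sorted_leq_nth geq_trans leqnn 0%N lambda_part.
  move=> /(_ (r.*2.+1 - j) (r.*2.+1 - i))%N; rewrite !inE size_tuple /geq /= /b.
  by move=> H; have := H _ _ _; lia.
split=> [/eqP|H]; last first.
  apply/eqP; rewrite eval_schur_eq0; apply/eqP.
  case: H => [[par|par]|[w [w_odd sym]]].
  - by apply: (@points_det_same_parity r _ false) => j; apply/negbTE/par.
  - exact: (@points_det_same_parity r _ true).
  apply: (@points_det_even_symmetric r _ (w + r.*2.+1)./2) => j.
  by rewrite rev_beta sym halfK; lia.
rewrite eval_schur_eq0 => /eqP det0.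
have /vanishes2_cases : vanishes rat 2 r b.
  apply: points_det_rev_eq0; rewrite -[RHS]det0; congr (\det _).
  by apply/matrixP => i j; rewrite !mxE bE.
case=> // [[p par]|[h sym]].
  have parE j : odd (beta lambda j) = p by rewrite -bE par.
  by left; case: p {par} parE => parE; [right|left] => j; rewrite parE.
(* No truncation occurs, by [sumE] below; the width is an even number minus an odd one. *)
right; exists (h.*2 - r.*2.+1)%N.
have sumE j : (tnth lambda j + tnth lambda (rev_ord j) + r.*2.+1 = h.*2)%N.
  rewrite -rev_beta -!bE rev_ordK -(sym j) // addnC; congr (_ + _)%N.
split=> [|i]; first by have := sumE ord0; lia.
by rewrite -(sumE i) addnK.
Qed.
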